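(* Let $\{\boldsymbol Z_n\}_{n\ge0}$ be a block lower Hessenberg branching process with type set $\mathcal{X}_d$ and phase partition $A_1,\dots,A_d$. If $\sup_{l\in A_i}q_{0,l}(A_j)<1$ for all $i,j\in\{1,\dots,d\}$, then $\boldsymbol q(A)=\boldsymbol q$ for every nonempty $A\in\sigma(A_1,\dots,A_d)$.
   Context: Fix an integer $1\le d<\infty$ and let $\mathcal{X}_d=\{\langle k,i\rangle: k\ge 0,\ 1\le i\le d\}$ (type $\langle k,i\rangle$ is in level $k$ and phase $i$), $A_i=\{\langle0,i\rangle,\langle1,i\rangle,\dots\}$; $\sigma(A_1,\dots,A_d)$ is the sigma-algebra generated by the partition $\{A_i\}$. A block lower Hessenberg branching process is a multitype Galton–Watson process $\{\boldsymbol Z_n\}_{n\ge0}$, $\boldsymbol Z_n=(Z_{n,j})_{j\in\mathcal{X}_d}$, started from one individual of type $\varphi_0$, in which each individual lives one generation and, independently of all others, an individual of type $j$ produces offspring vector $\boldsymbol r=(r_l)_{l\in\mathcal{X}_d}$ with probability $p_j(\boldsymbol r)$, where for $j$ in level $k$ the distribution $p_j$ is concentrated on vectors with $r_l=0$ for all $l$ in levels larger than $k+1$. $\mathbb P_i=\mathbb P(\cdot\mid\varphi_0=i)$. For $A\subseteq\mathcal{X}_d$: $q_{0,i}(A)=\mathbb P_i(\sum_{m\ge0}\sum_{j\in A}Z_{m,j}=0)$ is the probability that no individual with type in $A$ ever appears; $q_i(A)=\mathbb P_i(\exists n:\sum_{m\ge n}\sum_{j\in A}Z_{m,j}=0)$,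 $\boldsymbol q(A)=(q_i(A))_{i\in\mathcal{X}_d}$; and $\boldsymbol q=\boldsymbol q(\mathcal{X}_d)$ is the global extinction probability vector. *)

(* Defs.v *)
From HB Require Import structures.
From mathcomp Require Import all_boot all_order all_algebra.
From mathcomp Require Import finmap.
From mathcomp Require Import all_classical all_reals all_analysis.
Set Implicit Arguments.
Unset Strict Implicit.
Unset Printing Implicit Defensive.
Import Order.TTheory GRing.Theory Num.Theory.
Local Open Scope classical_set_scope.
Local Open Scope ring_scope.
Local Open Scope ereal_scope.

(* The type <k, i> of level k and phase i is the pair (k, i); phases are
   numbered from 0 to d - 1. *)
Definition types (d : nat) := (nat * 'I_d)%type.

Definition phase_set (d : nat) (i : 'I_d) : set (types d) :=
  [set x | x.2 = i].

Record offspring_law (R : realType) (d : nat)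
    (p : types d -> (types d -> nat) -> R) : Prop := {
  offspring_ge0 : forall j r, (0 <= p j r)%R ;
  offspring_sum1 : forall j, \esum_(r in [set: types d -> nat]) (p j r)%:E = 1
}.

Definition block_lower_hessenberg (R : realType) (d : nat)
    (p : types d -> (types d -> nat) -> R) : Prop :=
  forall j r, p j r != 0%R ->
    forall l : types d, (j.1.+1 < l.1)%N -> r l = 0%N.

(* Mutual independence of discrete random vectors: since their laws are given
   by mass functions, the product rule on point events suffices. *)
Definition discrete_independent (R : realType) (dW : measure_display)
    (W : measurableType dW) (P : probability W R) (I : choiceType) (E : Type)
    (xi : I -> W -> E) : Prop :=
  forall (S : {fset I}) (r : I -> E),
    P [set w | forall s, s \in S -> xi s w = r s] =
    \prod_(s <- S) P [set w | xi s w = r s].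

(* xi (n, j, k) is the offspring vector of the k-th individual of type j in
   generation n; it is used only when k < Z n w j, but is defined for all k. *)
Record offspring_family (R : realType) (d : nat) (dW : measure_display)
    (W : measurableType dW) (p : types d -> (types d -> nat) -> R)
    (P : probability W R) (xi : nat * types d * nat -> W -> types d -> nat)
    : Prop := {
  offspring_measurable :
    forall s l, measurable_fun [set: W] (fun w => xi s w l) ;
  offspring_distribution :
    forall n j k r, P [set w | xi (n, j, k) w = r] = (p j r)%:E ;
  offspring_independent : discrete_independent P xi
}.

(* The sum over the countably many parent types is taken in \bar R, so that
   it has its true value without any finiteness assumption. *)
Definition galton_watson (R : realType) (d : nat) (dW : measure_display)
    (W : measurableType dW) (p : types d -> (types d -> nat) -> R)
    (P : probability W R) (i : types d) (Z : nat -> W -> types d -> nat)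
    : Prop :=
  [/\ forall n l, measurable_fun [set: W] (fun w => Z n w l),
      {ae P, forall w, forall l, Z 0%N w l = (l == i)} &
      exists2 xi : nat * types d * nat -> W -> types d -> nat,
        offspring_family p P xi &
        {ae P, forall w, forall n l,
          (Z n.+1 w l)%:R%:E =
          \esum_(j in [set: types d])
            (\sum_(k < Z n w j) xi (n, j, k : nat) w l)%N%:R%:E :> \bar R}].

(* Under P i the process Z starts from one individual of type i. *)
Record block_LH_branching_process (R : realType) (d : nat)
    (dW : measure_display) (W : measurableType dW)
    (p : types d -> (types d -> nat) -> R)
    (P : types d -> probability W R) (Z : nat -> W -> types d -> nat)
    : Prop := {
  blhbp_law : offspring_law p ;
  blhbp_hessenberg : block_lower_hessenberg p ;
  blhbp_process : forall i, galton_watson p (P i) i Z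
}.

(* Total number of individuals with type in A in generations n, n + 1, ... *)
Definition visits_from (R : realType) (d : nat) (W : Type)
    (Z : nat -> W -> types d -> nat) (A : set (types d)) (n : nat) (w : W)
    : \bar R :=
  \sum_(n <= m <oo) \esum_(j in A) (Z m w j)%:R%:E.

Definition q0 (R : realType) (d : nat) (dW : measure_display)
    (W : measurableType dW) (P : types d -> probability W R)
    (Z : nat -> W -> types d -> nat) (A : set (types d)) (i : types d)
    : \bar R :=
  P i [set w | visits_from R Z A 0 w = 0].

Definition q (R : realType) (d : nat) (dW : measure_display)
    (W : measurableType dW) (P : types d -> probability W R)
    (Z : nat -> W -> types d -> nat) (A : set (types d)) (i : types d)
    : \bar R :=
  P i [set w | exists n, visits_from R Z A n w = 0].

(* Main.v *)
Require Import Defs.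
From HB Require Import structures.
From mathcomp Require Import all_boot all_order all_algebra.
From mathcomp Require Import finmap.
From mathcomp Require Import all_classical all_reals all_analysis.
From mathcomp Require Import ring lra.
Set Implicit Arguments.
Unset Strict Implicit.
Unset Printing Implicit Defensive.
Import Order.TTheory GRing.Theory Num.Theory.
Local Open Scope classical_set_scope.
Local Open Scope ring_scope.
Local Open Scope ereal_scope.

(* Every type reaches A with probability at least 1 - c, for some c < 1.  Let
   F_t be the event that A is not visited in generations N, ..., t and that
   generation t is not empty.  Given the history up to t, any individual alive
   at time t has descendants in A with probability at least 1 - c, so the
   probability of F_t and of no visit to A from t on is at most c P(F_t).  The
   events F_t decrease to the event F that the process survives without visiting
   A after N, which is contained in all the former events; hence P(F) <= c P(F)
   and P(F) = 0.  The branching property behind the conditional bound is obtained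
   by revealing the offspring vectors of a generation one individual at a time. *)

(** * Sums of nonnegative extended reals over arbitrary index types *)

Lemma esumZl (R : realType) (T : choiceType) (c : R) (a : T -> \bar R) :
  (0 <= c)%R -> (forall x, 0 <= a x) ->
  \esum_(x in [set: T]) (c%:E * a x) = c%:E * \esum_(x in [set: T]) a x.
Proof.
have le_scale (c' : R) (b : T -> \bar R) : (0 <= c')%R -> (forall x, 0 <= b x) ->
    \esum_(x in [set: T]) (c'%:E * b x) <= c'%:E * \esum_(x in [set: T]) b x.
  move=> c0 b0; apply: ge_ereal_sup => _ [X [finX XT] <-].
  rewrite fsbig_finite//= -ge0_sume_distrr//; apply: lee_wpmul2l => //.
  rewrite -fsbig_finite//; apply: ereal_sup_ubound; by exists X.
rewrite le_eqVlt => /predU1P[<-|c0] a0.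
  by rewrite mul0e esum1// => x _; rewrite mul0e.
apply/eqP; rewrite eq_le le_scale ?(ltW c0)//=.
(* The reverse bound is [le_scale] again, with factor [c^-1] and the scaled family. *)
rewrite -[leRHS]mul1e -(@divff _ c) ?gt_eqF// EFinM -muleA lee_pmul2l//.
apply: le_trans (le_scale _ _ _ _); last 2 first.
- by rewrite invr_ge0 ltW.
- by move=> x; rewrite mule_ge0// lee_fin ltW.
rewrite le_eqVlt; apply/orP; left; apply/eqP; apply: eq_esum => x _.
by rewrite muleA -EFinM mulVf ?gt_eqF// mul1e.
Qed.

Lemma esum_eq0P (R : realType) (T : choiceType) (D : set T) (a : T -> \bar R) :
  (forall x, 0 <= a x) ->
  \esum_(x in D) a x = 0 <-> (forall x, D x -> a x = 0).
Proof.
move=> a0; split=> [e0 x Dx|]; last exact: esum1.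
apply/eqP; rewrite eq_le a0 andbT -e0; apply: esum_ge.
exists [set x]; first by split=> [|y ->]; [exact: finite_set1|].
by rewrite fsbig_set1.
Qed.

(** * Finitely supported configurations and their monomials *)

Section Configurations.
Context {R : realType} {d : nat}.
Implicit Types (z r : types d -> nat) (s : types d -> R).

Definition supp z := [set l | z l != 0%N].
Definition finsupport z := finite_set (supp z).

Lemma finsupportD z r : finsupport z -> finsupport r ->
  finsupport (fun l => z l + r l)%N.
Proof.
move=> fz fr; apply: (@sub_finite_set _ _ (supp z `|` supp r)).
  by move=> l; rewrite /supp/= addn_eq0 negb_and => /orP.
by rewrite finite_setU.
Qed.

(** A finitely supported vector is determined by its finite graph, a sequence over a countable type.
    This makes total probability over offspring vectors a countable sum. *)
Lemma countable_finsupport : countable [set z | finsupport z].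
Proof.
apply/countable_injP.
exists (fun z => choice.pickle ([seq (l, z l) | l <- fset_set (supp z)] : seq (nat * 'I_d * nat))).
(* Equal graphs give equal values on the support of [z]; exchanging the two vectors covers the
   support of [r]. *)
suff half z r : finsupport z -> finsupport r ->
    [seq (l, z l) | l <- fset_set (supp z)] =
    [seq (l, r l) | l <- fset_set (supp r)] ->
    forall l, z l != 0%N -> z l = r l.
  move=> z r; rewrite !inE /= => fz fr /(pcan_inj choice.pickleK) e.
  apply/funext => l; have [z0|z0] := eqVneq (z l) 0%N; last exact: (half _ _ fz fr).
  by have [r0|r0] := eqVneq (r l) 0%N; [rewrite z0 r0|rewrite (half _ _ fr fz)].
move=> fz fr e l zl.
have : (l, z l) \in [seq (l, z l) | l <- fset_set (supp z)].
  by apply/mapP; exists l => //; rewrite in_fset_set// inE.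
by rewrite e => /mapP[l' _ [-> ->]].
Qed.

(** The multivariate power [s^z]. For infinite support [fset_set] is empty and the value is 1;
    offspring laws give such vectors mass zero. *)
Definition monom s z : R := (\prod_(l <- fset_set (supp z)) s l ^+ z l)%R.

Lemma monom_fset s z (X : {fset types d}) : (forall l, z l != 0%N -> l \in X) ->
  monom s z = (\prod_(l <- X) s l ^+ z l)%R.
Proof.
move=> zX; have fz : finsupport z.
  by apply: (@sub_finite_set _ _ [set` X]) => // l /zX.
rewrite /monom; apply: big_fset_incl => [|l lX].
  by apply/fsubsetP => l; rewrite in_fset_set// inE => /zX.
by rewrite in_fset_set// notin_setE => /negP; rewrite negbK => /eqP ->.
Qed.

Lemma monomD s z r : finsupport z -> finsupport r ->
  monom s (fun l => z l + r l)%N = (monom s z * monom s r)%R.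
Proof.
move=> fz fr; have X l : ((z l != 0) || (r l != 0))%N ->
    l \in (fset_set (supp z) `|` fset_set (supp r))%fset.
  by rewrite in_fsetU !in_fset_set// => /orP[?|?]; apply/orP; [left|right]; apply/mem_set.
rewrite !(@monom_fset s _ (fset_set (supp z) `|` fset_set (supp r))%fset).
- by rewrite -big_split; apply: eq_bigr => l _; rewrite exprD.
- by move=> l rl; rewrite X// rl orbT.
- by move=> l zl; rewrite X// zl.
- by move=> l; rewrite addn_eq0 negb_and => /X.
Qed.

Lemma monom0 s : monom s (fun=> 0%N) = 1%R.
Proof. by rewrite (@monom_fset s _ fset0)// big_seq_fset0. Qed.

Lemma monom1 s l : monom s (fun l' => (l' == l) : nat) = s l.
Proof.
rewrite (@monom_fset s _ [fset l]%fset) ?big_seq_fset1 ?eqxx ?expr1//.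
by move=> l'; rewrite in_fset1; case: (l' == l).
Qed.

Lemma monom_ge0 s z : (forall l, 0 <= s l)%R -> (0 <= monom s z)%R.
Proof. by move=> s0; apply: prodr_ge0 => l _; rewrite exprn_ge0. Qed.

Lemma monom_le1 s z : (forall l, 0 <= s l <= 1)%R -> (monom s z <= 1)%R.
Proof.
move=> s01; apply: Num.Theory.prodr_ile1 => l _.
by have /andP[s0 s1] := s01 l; rewrite exprn_ge0//= exprn_ile1.
Qed.

(** All factors are at most 1, so a single living individual of type [l] already bounds the
    product. *)
Lemma monom_le s z l : (forall l, 0 <= s l <= 1)%R -> finsupport z ->
  z l != 0%N -> (monom s z <= s l)%R.
Proof.
move=> s01 fz zl; have /andP[s0 s1] := s01 l.
rewrite /monom (big_fsetD1 l) /=; last by rewrite in_fset_set// inE.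
rewrite -[leRHS]mulr1 ler_pM ?exprn_ge0//.
- by apply: prodr_ge0 => k _; have /andP[? ?] := s01 k; rewrite exprn_ge0.
- by rewrite ler_iXnr ?lt0n.
- apply: Num.Theory.prodr_ile1 => k _.
  by have /andP[? ?] := s01 k; rewrite exprn_ge0//= exprn_ile1.
Qed.

End Configurations.

(** * Measurability and almost sure events *)

Lemma countable_bigcap_measurable {dW : measure_display} {W : measurableType dW}
    (I : countType) (D : set I) (F : I -> set W) :
  (forall i, D i -> measurable (F i)) -> measurable (\bigcap_(i in D) F i).
Proof.
move=> mF; rewrite -[X in measurable X]setCK setC_bigcap; apply: measurableC.
rewrite bigcup_mkcond; apply: countable_bigcupT_measurable => // i.
by case: ifPn => // /set_mem Di; apply: measurableC; exact: mF.
Qed.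

Lemma probability_setI1 {R : realType} {dW : measure_display}
    {W : measurableType dW} (P : probability W R) (H V : set W) :
  measurable H -> measurable V -> P H = 1 -> P (H `&` V) = P V.
Proof.
move=> mH mV PH; rewrite [RHS](measureDI _ mV mH) setIC.
rewrite (@subset_measure0 _ _ _ _ (V `\` H) (~` H)) ?add0e//.
- exact: measurableD.
- exact: measurableC.
- by rewrite [LHS]probability_setC// PH subee.
Qed.

(** * Revealing independent offspring vectors one at a time *)

Section OffspringFamily.
Context {R : realType} {d : nat} {dW : measure_display} {W : measurableType dW}.
Context {p : types d -> (types d -> nat) -> R} {P : probability W R}.
Context {xi : nat * types d * nat -> W -> types d -> nat}.
Hypothesis law : offspring_law p.
Hypothesis hess : block_lower_hessenberg p.
Hypothesis family : offspring_family p P xi.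

Notation index := (nat * types d * nat)%type.
Implicit Types (H U V : set W) (D : set index) (s : index) (r : types d -> nat).

Definition draw s r := [set w | xi s w = r].

(** The Hessenberg condition enters here: children of a parent in level [k] lie in levels 0 to
    [k + 1], and each level has [d] types. *)
Lemma p_neq0_finsupport j r : p j r != 0%R -> finsupport r.
Proof.
move=> /hess pr; apply: (@sub_finite_set _ _ (`I_j.1.+2 `*` [set: 'I_d])).
  move=> l; rewrite /supp/= => rl; split=> //=; rewrite ltnS leqNgt.
  by apply: contraNN rl => /pr ->.
by apply: finite_setX; [exact: finite_II|exact: finite_finset].
Qed.

Lemma draw_measurable s r : measurable (draw s r).
Proof.
have -> : draw s r = \bigcap_(l in [set: types d]) ((fun w => xi s w l) @^-1` [set r l]).
  apply/seteqP; split=> w; first by move=> /= <- l _.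
  by move=> h; apply/funext => l; exact: h.
apply: (@countable_bigcap_measurable _ _ (nat * 'I_d)%type) => l _.
rewrite -[X in measurable X]setTI.
exact: (offspring_measurable family s l).
Qed.

Lemma P_draw s r : P (draw s r) = (p s.1.2 r)%:E.
Proof. by case: s => -[n j] k; exact: offspring_distribution family _ _ _ _. Qed.

Lemma P_fin_num H : measurable H -> P H = (fine (P H))%:E.
Proof. by move=> mH; rewrite fineK// fin_num_measure. Qed.

(* H is independent of the offspring vectors with indices in D, the individuals
   not revealed yet. *)
Definition fresh H D := measurable H /\
  forall (S : {fset index}) (r : index -> types d -> nat),
    (forall s, s \in S -> D s) ->
    P (H `&` [set w | forall s, s \in S -> xi s w = r s]) =
    P H * (\prod_(s <- S) p s.1.2 (r s))%R%:E.

Lemma freshT D H : measurable H -> P H = 1 -> fresh H D.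
Proof.
move=> mH PH; split=> // S r _; rewrite PH mul1e -prodEFin.
rewrite probability_setI1//; last first.
  rewrite [X in measurable X](_ : _ = \bigcap_(s in [set` S]) draw s (r s)) //.
  by apply: fin_bigcap_measurable => // s _; exact: draw_measurable.
rewrite (offspring_independent family); apply: eq_bigr => s _.
exact: P_draw.
Qed.

Lemma freshS H D D' : D' `<=` D -> fresh H D -> fresh H D'.
Proof.
by move=> D'D [mH HD]; split=> // S r SD'; apply: HD => s /SD' /D'D.
Qed.

Lemma fresh_draw H D s r : fresh H D -> D s ->
  P (H `&` draw s r) = P H * (p s.1.2 r)%:E.
Proof.
move=> [mH HD] Ds.
have := HD [fset s]%fset (fun=> r); rewrite big_seq_fset1 => <-.
  by congr (P (_ `&` _)); apply/seteqP; split=> w /=;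
    [move=> wr s'; rewrite in_fset1 => /eqP ->|apply; rewrite in_fset1].
by move=> s'; rewrite in_fset1 => /eqP ->.
Qed.

(** Revealing one vector keeps the others fresh: the product rule for [H] on [s] together with [S]
    splits off the factor of [s]. *)
Lemma freshI H D s r : fresh H D -> D s ->
  fresh (H `&` draw s r) (D `\ s).
Proof.
move=> HD Ds; have [mH Hprod] := HD.
split=> [|S r' SD]; first by apply: measurableI => //; exact: draw_measurable.
have sS : s \notin S by apply/negP => /SD[_]; apply.
rewrite (fresh_draw _ HD Ds) -muleA -EFinM.
pose r'' := fun s' => if s' == s then r else r' s'.
have := Hprod (s |` S)%fset r''; rewrite big_fsetU1//= {2}/r'' eqxx.
rewrite (@eq_big_seq _ _ _ _ S _ (fun s => p s.1.2 (r' s))) /=; last first.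
  by move=> s' s'S; rewrite /r''; case: eqVneq => // e; rewrite -e s'S in sS.
move=> <-; last by move=> s'; rewrite in_fset1U => /predU1P[->//|/SD[]].
rewrite -setIA; congr (P (_ `&` _)); apply/seteqP; split=> w /=.
  move=> [ws wS] s'; rewrite in_fset1U /r''; case: eqVneq => [->//|_ /=].
  exact: wS.
move=> h; split; first by have := h s; rewrite fset1U1 /r'' eqxx; apply.
move=> s' s'S; have := h s'; rewrite in_fset1U s'S orbT /r''.
by case: eqVneq => [e|_]; [rewrite -e s'S in sS|apply].
Qed.

(** Total probability over a possibly uncountable value space: the vectors of positive mass are
    countably many and their masses sum to 1, so almost surely one of them is drawn. *)
Lemma draw_esum s U : measurable U ->
  P U = \esum_(r in [set: types d -> nat]) P (U `&` draw s r).
Proof.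
move=> mU; have md := draw_measurable s; pose D := [set r | p s.1.2 r != 0%R].
have PD0 V r : measurable V -> ~ D r -> P (V `&` draw s r) = 0.
  move=> mV /negP; rewrite negbK => /eqP pr0.
  apply: (@subset_measure0 _ _ _ _ _ (draw s r)) => //.
    exact: measurableI.
  by rewrite [LHS]P_draw pr0.
have /countable_injP[g ginj] : countable D.
  apply: sub_countable countable_finsupport; apply: subset_card_le => r.
  exact: p_neq0_finsupport.
(* The pieces are indexed by naturals through the injection [g], so that countable additivity
   applies; off the image of [g] they are empty. *)
pose F V n := \bigcup_(r in [set r | D r /\ g r = n]) (V `&` draw s r).
have FE V r : D r -> F V (g r) = V `&` draw s r.
  move=> Dr; apply/seteqP; split=> [w [r' [Dr' grr'] Vr']|w Vr]; last by exists r.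
  by rewrite -(ginj _ _ _ _ grr')// inE.
have F0 V n : ~ (g @` D) n -> F V n = set0.
  by move=> gn; apply/seteqP; split=> // w [r [Dr gr] _]; exfalso; apply: gn; exists r.
have mF V : measurable V -> forall n, measurable (F V n).
  move=> mV n; have [[r Dr <-]|gn] := pselect ((g @` D) n); last by rewrite F0.
  by rewrite FE//; apply: measurableI => //; exact: draw_measurable.
have sumF V : measurable V ->
    P (\bigcup_n F V n) = \esum_(r in [set: types d -> nat]) P (V `&` draw s r).
  move=> mV; rewrite measure_bigcup//=; last 2 first.
  - by move=> n _; exact: mF.
  - move=> m n _ _ [w [[r [Dr <-] [_ wr]] [r' [Dr' <-] [_ wr']]]].
    by rewrite -wr wr'.
  rewrite nneseries_esum// (_ : [set x | x \in setT] = setT); last first.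
    by apply/seteqP; split=> x //= _; rewrite in_setT.
  transitivity (\esum_(n in g @` D) P (F V n)).
    rewrite [RHS]esum_mkcond; apply: eq_esum => n _; case: ifPn => //.
    by rewrite notin_setE => gn; rewrite F0// measure0.
  rewrite esum_image//; rewrite esum_mkcond; apply: eq_esum => r _.
  case: ifPn; first by rewrite inE => /FE ->.
  by rewrite notin_setE => Dr; rewrite PD0.
have PT : P (\bigcup_n F setT n) = 1.
  rewrite sumF// -(offspring_sum1 law s.1.2); apply: eq_esum => r _.
  by rewrite setTI P_draw.
rewrite -sumF// -(probability_setI1 _ mU PT); last by apply: bigcup_measurable => *; exact: mF.
congr (P _); apply/seteqP; split=> w.
  by move=> [[n _ [r [Dr gr] [_ wr]]] Uw]; exists n => //; exists r.
by move=> [n _ [r [Dr gr] [Uw wr]]]; split=> //; exists n => //; exists r.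
Qed.

Lemma draw_null H D s r U : measurable U -> fresh H D -> D s -> p s.1.2 r = 0%R ->
  P (H `&` U `&` draw s r) = 0.
Proof.
move=> mU HD Ds pr0; apply/eqP; rewrite -measure_le0.
apply: (@le_trans _ _ (P (H `&` draw s r))); last first.
  by rewrite (fresh_draw _ HD Ds) pr0 mule0.
have mr := draw_measurable s r; have mH := HD.1.
apply: le_measure; rewrite ?inE//; try by repeat apply: measurableI.
by move=> w [[]].
Qed.

End OffspringFamily.

(** * Generating functions and the branching property *)

Section Evolution.
Context {R : realType} {d : nat} {dW : measure_display} {W : measurableType dW}.
Context {p : types d -> (types d -> nat) -> R} {P : probability W R}.
Context {xi : nat * types d * nat -> W -> types d -> nat}.
Context {Z : nat -> W -> types d -> nat} {A : set (types d)} {G : set W}.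
Hypothesis law : offspring_law p.
Hypothesis hess : block_lower_hessenberg p.
Hypothesis family : offspring_family p P xi.
Hypothesis mZ : forall n l, measurable_fun [set: W] (fun w => Z n w l).
Hypothesis evolution : forall w, G w -> forall n l,
  (Z n.+1 w l)%:R%:E = \esum_(j in [set: types d])
     (\sum_(k < Z n w j) xi (n, j, k : nat) w l)%N%:R%:E :> \bar R.

Notation index := (nat * types d * nat)%type.

Definition individuals n (z : types d -> nat) : seq index :=
  [seq (n, l, k) | l <- fset_set (supp z), k <- iota 0 (z l)].

Lemma individuals_uniq n z : uniq (individuals n z).
Proof.
apply: allpairs_uniq_dep => [|l _|[l k] [l' k'] _ _ /= [-> ->]//].
- exact: fset_uniq.
- exact: iota_uniq.
Qed.

Lemma individuals_generation n z s : s \in individuals n z -> s.1.1 = n.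
Proof. by case/allpairsPdep => l [k [_ _ ->]]. Qed.

(** With finitely many parents the extended sum in the evolution equation is a finite sum of
    naturals, so the equation descends to [nat]. *)
Lemma next_generation w n z : G w -> finsupport z -> (forall l, Z n w l = z l) ->
  forall l, Z n.+1 w l = (\sum_(s <- individuals n z) xi s w l)%N.
Proof.
move=> Gw fz Zz l; apply/eqP; rewrite -(eqr_nat R) -eqe; apply/eqP.
rewrite evolution//.
transitivity (\esum_(j in supp z)
    (\sum_(0 <= k < z j) xi (n, j, k) w l)%N%:R%:E : \bar R).
  rewrite [RHS]esum_mkcond; apply: eq_esum => j _; rewrite Zz.
  case: ifPn => [_|]; first by rewrite big_mkord.
  by rewrite notin_setE => /negP; rewrite negbK => /eqP ->; rewrite big_ord0.
rewrite esum_fset// fsbig_finite//= sumEFin -natr_sum; congr (_%:R%:E).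
by rewrite /individuals big_allpairs_dep; apply: eq_bigr => j _; rewrite /index_iota subn0.
Qed.

Lemma prod_individuals (s : types d -> R) n z :
  (\prod_(x <- individuals n z) s x.1.2)%R = monom s z.
Proof.
rewrite /individuals big_allpairs_dep /monom; apply: eq_bigr => l _ /=.
by rewrite big_const_seq count_predT size_iota -Monoid.iteropE.
Qed.

(** The offspring generating function. For [s] with entries in [0, 1] the extended sum is at most 1,
    so [fine] loses nothing. *)
Definition pgf (s : types d -> R) (j : types d) : R :=
  fine (\esum_(r in [set: types d -> nat]) (p j r * monom s r)%:E).

Section PGF.
Variable s : types d -> R.
Hypothesis s01 : forall l, (0 <= s l <= 1)%R.

Let s_ge0 l : (0 <= s l)%R. Proof. by have /andP[] := s01 l. Qed.

Lemma term_ge0 j r : (0 <= p j r * monom s r)%R.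
Proof. by rewrite mulr_ge0 ?(offspring_ge0 law) ?monom_ge0. Qed.

Lemma pgf_esum_le1 j :
  \esum_(r in [set: types d -> nat]) (p j r * monom s r)%:E <= 1.
Proof.
rewrite -(offspring_sum1 law j); apply: le_esum => r _; rewrite lee_fin.
by rewrite ler_piMr ?(offspring_ge0 law) ?monom_le1.
Qed.

Lemma pgfE j :
  \esum_(r in [set: types d -> nat]) (p j r * monom s r)%:E = (pgf s j)%:E.
Proof.
rewrite fineK// ge0_fin_numE; first exact: le_lt_trans (pgf_esum_le1 j) (ltry _).
by apply: esum_ge0 => r _; rewrite lee_fin term_ge0.
Qed.

Lemma pgf01 j : (0 <= pgf s j <= 1)%R.
Proof.
rewrite -!lee_fin -pgfE pgf_esum_le1 andbT.
by apply: esum_ge0 => r _; rewrite lee_fin term_ge0.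
Qed.

End PGF.

(* The probability that the progeny of an individual of type j, itself included,
   does not visit A during its first m + 1 generations. *)
Fixpoint avoid m (j : types d) : R :=
  ((j \notin A)%:R * (if m is m'.+1 then pgf (avoid m') j else 1))%R.

Lemma avoid01 m j : (0 <= avoid m j <= 1)%R.
Proof.
elim: m j => [|m IH] j /=; first by rewrite mulr1; case: (j \notin A); rewrite /= ?lexx ?ler01.
case: (j \notin A); rewrite /= ?mul1r ?mul0r ?lexx ?ler01//.
exact: pgf01.
Qed.

Lemma monom_avoid_eq0 m z l : finsupport z -> A l -> z l != 0%N -> monom (avoid m) z = 0%R.
Proof.
move=> fz Al zl; apply/eqP; rewrite eq_le monom_ge0 ?andbT; last first.
  by move=> k; have /andP[] := avoid01 m k.
apply: le_trans (monom_le _ fz zl) _; first exact: avoid01.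
by case: m => [|m] /=; rewrite (mem_set Al) mul0r.
Qed.

(** On types outside [A] the indicator in [avoid] is 1, which leaves one step of the recursion. *)
Lemma monom_avoid m z : finsupport z -> (forall l, A l -> z l = 0%N) ->
  monom (avoid m) z = if m is m'.+1 then monom (pgf (avoid m')) z else 1%R.
Proof.
move=> fz zA; transitivity (monom (fun j => if m is m'.+1 then pgf (avoid m') j else 1%R) z).
  rewrite /monom big_seq [RHS]big_seq; apply: eq_bigr => l.
  rewrite in_fset_set// inE /supp /= => zl; congr (_ ^+ _)%R.
  have lA : l \notin A by rewrite notin_setE => /zA /eqP; exact/negP.
  by case: m => [|m] /=; rewrite lA mul1r.
case: m => [|m]//; rewrite /monom big1// => l _; exact: expr1n.
Qed.

Definition no_visit n m :=
  [set w | forall k l, (n <= k <= n + m)%N -> A l -> Z k w l = 0%N].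

Lemma Zeq_measurable n l c : measurable [set w | Z n w l = c].
Proof.
rewrite (_ : [set w | _] = (fun w => Z n w l) @^-1` [set c])// -[X in measurable X]setTI.
exact: (mZ n l).
Qed.

Lemma no_visit_measurable n m : measurable (no_visit n m).
Proof.
rewrite (_ : no_visit n m = \bigcap_(k in [set k : nat | (n <= k <= n + m)%N])
    \bigcap_(l in (A : set (nat * 'I_d)%type)) [set w | Z k w l = 0%N]).
  apply: countable_bigcap_measurable => k _.
  apply: countable_bigcap_measurable => l _; exact: Zeq_measurable.
by apply/seteqP; split=> w h k => [kn l|l]; [|move=> kn]; exact: h.
Qed.

Definition future n := [set s : index | (n <= s.1.1)%N].

Notation fresh := (@fresh R d dW W p P xi).
Notation draw := (@draw d W xi).

(* S lists the parents in generation n - 1 not revealed yet, and a is the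
   total offspring of those already revealed. *)
Lemma no_visit_draws m n
  (IH : forall H z, H `<=` G -> fresh H (future n) -> finsupport z ->
     (forall w, H w -> forall l, Z n w l = z l) ->
     P (H `&` no_visit n m) = P H * (monom (avoid m) z)%:E)
  S H D a : H `<=` G -> uniq S -> fresh H D -> future n `<=` D ->
  (forall s, s \in S -> D s /\ (s.1.1 < n)%N) -> finsupport a ->
  (forall w, H w -> forall l, Z n w l = (a l + \sum_(s <- S) xi s w l)%N) ->
  P (H `&` no_visit n m) =
  P H * (monom (avoid m) a * \prod_(s <- S) pgf (avoid m) s.1.2)%R%:E.
Proof.
elim: S H D a => [|s S IHS] H D a HG uS HD nD SD fa ZH.
  rewrite big_nil mulr1; apply: IH => //; first exact: freshS HD.
  by move=> w Hw l; rewrite ZH// big_nil addn0.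
have [Ds sn] := SD s (mem_head _ _).
have mNV := no_visit_measurable n m; have mH := HD.1.
rewrite (draw_esum law hess family s); last exact: measurableI.
(* The factor independent of the vector drawn at [s]; summing the rest over all draws produces
   [pgf (avoid m) s.1.2]. *)
set c := (fine (P H) * (monom (avoid m) a * \prod_(s' <- S) pgf (avoid m) s'.1.2))%R.
have c0 : (0 <= c)%R.
  rewrite mulr_ge0 ?fine_ge0// mulr_ge0 ?monom_ge0//.
    by move=> l; have /andP[] := avoid01 m l.
  by apply: prodr_ge0 => s' _; have /andP[] := pgf01 (avoid01 m) s'.1.2.
transitivity (\esum_(r in [set: types d -> nat])
    (c%:E * (p s.1.2 r * monom (avoid m) r)%:E)); last first.
  rewrite esumZl//; last by move=> r; rewrite lee_fin term_ge0//; exact: avoid01.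
  rewrite pgfE; last exact: avoid01.
  rewrite (P_fin_num mH) big_cons -!EFinM /c; congr (_%:E).
  by rewrite -!mulrA; congr (_ * (_ * _))%R; rewrite mulrC.
(* Vectors of mass zero are set aside because they may lack finite support, which the induction
   needs. *)
apply: eq_esum => r _; have [pr0|pr0] := eqVneq (p s.1.2 r) 0%R.
  by rewrite (draw_null family _ HD Ds)// pr0 mul0r mule0.
have fr := p_neq0_finsupport hess pr0.
rewrite setIAC.
rewrite (IHS _ (D `\ s) (fun l => a l + r l)%N).
- rewrite (fresh_draw _ HD Ds) (P_fin_num mH) -!EFinM monomD//; congr (_%:E).
  by rewrite /c; ring.
- by move=> w [/HG].
- by move: uS => /= /andP[].
- exact: (@freshI _ _ _ _ _ _ _ family _ _ _ r HD Ds).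
- by move=> s' ns'; split; [exact: nD|move=> /= e; move: ns'; rewrite e /future/= leqNgt sn].
- move=> s' s'S; have [|Ds' s'n] := SD s'; first by rewrite inE s'S orbT.
  by split=> //; split=> // /= e; move: uS; rewrite /= -e s'S.
- exact: finsupportD.
- by move=> w [Hw wr] l; rewrite ZH// big_cons addnA -wr.
Qed.

(** The branching property: once generation [n] is known, the progenies of its individuals avoid [A]
    independently, so their probabilities multiply. The induction on [m] reveals the offspring of
    generation [n]. *)
Lemma no_visit_monom m n H z : H `<=` G -> fresh H (future n) -> finsupport z ->
  (forall w, H w -> forall l, Z n w l = z l) ->
  P (H `&` no_visit n m) = P H * (monom (avoid m) z)%:E.
Proof.
elim: m n H z => [|m IH] n H z HG HD fz ZH.
all: have [[l [Al zl]]|zA] := pselect (exists l, A l /\ z l != 0%N).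
1,3: rewrite (monom_avoid_eq0 _ fz Al zl) mule0 (_ : _ `&` _ = set0) ?measure0//;
  by apply/seteqP; split=> // w [Hw /(_ n l)]; rewrite leqnn leq_addr ZH//;
  move=> /(_ isT Al) /eqP; exact/negP.
all: have {}zA l : A l -> z l = 0%N by
  move=> Al; apply/eqP; apply: contra_notT zA => zl; exists l.
all: rewrite monom_avoid//.
  rewrite mule1; congr (P _); apply/seteqP; split=> [w []//|w Hw]; split=> // k l.
  by rewrite addn0 -eqn_leq => /eqP <-; rewrite ZH//; exact: zA.
(* Generation [n] equals [z], which misses [A], so only generations [n + 1] to [n + 1 + m] remain to
   be checked. *)
transitivity (P (H `&` no_visit n.+1 m)).
  congr (P _); apply/seteqP; split=> w [Hw NVw]; split=> // k l /andP[nk km] Al.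
    by apply: NVw => //; rewrite (ltnW nk) -addSnnS.
  move: nk; rewrite leq_eqVlt => /predU1P[<-|nk]; first by rewrite ZH//; exact: zA.
  by apply: NVw => //; rewrite nk addSnnS.
rewrite (@no_visit_draws m n.+1 (IH n.+1) (individuals n z) H (future n) (fun=> 0%N))//.
- by rewrite monom0 mul1r prod_individuals.
- exact: individuals_uniq.
- by move=> s /ltnW.
- by move=> s /individuals_generation sn; rewrite /future /= sn.
- by apply: (sub_finite_set (B := set0)).
- by move=> w Hw l; rewrite (next_generation (HG _ Hw) fz (ZH _ Hw)).
Qed.


(** Both sides are sums over the draws not yet revealed, so a bound for histories that determine
    generation [n] extends to those that determine only its parents. *)
Lemma draws_contract n U V (c : R) (H0 : set W) : (0 <= c)%R ->
  measurable U -> measurable V ->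
  (forall H z, H `<=` H0 -> fresh H (future n) -> finsupport z ->
    (forall w, H w -> forall l, Z n w l = z l) ->
    P (H `&` U) <= c%:E * P (H `&` V)) ->
  forall S H D a, H `<=` H0 -> uniq S -> fresh H D -> future n `<=` D ->
  (forall s, s \in S -> D s /\ (s.1.1 < n)%N) -> finsupport a ->
  (forall w, H w -> forall l, Z n w l = (a l + \sum_(s <- S) xi s w l)%N) ->
  P (H `&` U) <= c%:E * P (H `&` V).
Proof.
move=> c0 mU mV leUV; elim=> [|s S IHS] H D a HH0 uS HD nD SD fa ZH.
  apply: (leUV _ a) => //; first exact: freshS HD.
  by move=> w Hw l; rewrite ZH// big_nil addn0.
have [Ds sn] := SD s (mem_head _ _).
have mH := HD.1.
rewrite !(@draw_esum _ _ _ _ _ _ _ law hess family s (H `&` _)); try exact: measurableI.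
rewrite -esumZl//; apply: le_esum => r _; have [pr0|pr0] := eqVneq (p s.1.2 r) 0%R.
  by rewrite (draw_null family mU HD Ds)// (draw_null family mV HD Ds)// mule0.
rewrite (setIAC H U) (setIAC H V).
apply: (IHS _ (D `\ s) (fun l => a l + r l)%N).
- by move=> w [/HH0].
- by move: uS => /= /andP[].
- exact: (@freshI _ _ _ _ _ _ _ family _ _ _ r HD Ds).
- by move=> s' ns'; split; [exact: nD|move=> /= e; move: ns'; rewrite e /future/= leqNgt sn].
- move=> s' s'S; have [|Ds' s'n] := SD s'; first by rewrite inE s'S orbT.
  by split=> //; split=> // /= e; move: uS; rewrite /= -e s'S.
- exact: finsupportD fa (p_neq0_finsupport hess pr0).
- by move=> w [Hw wr] l; rewrite ZH// big_cons addnA -wr.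
Qed.

(** * Survival without visits to [A] *)

Definition never n := [set w | forall k l, (n <= k)%N -> A l -> Z k w l = 0%N].

Definition alive n := [set w | exists l, Z n w l != 0%N].

(** The event F_n; for [n < N] only the condition of being alive remains. *)
Definition unseen N n :=
  [set w | forall k l, (N <= k <= n)%N -> A l -> Z k w l = 0%N] `&` alive n.

Lemma never_no_visit n : never n = \bigcap_m no_visit n m.
Proof.
apply/seteqP; split=> w h; first by move=> m _ k l /andP[nk _]; exact: h.
move=> k l nk; apply: (h k) => //; by rewrite nk leq_addl.
Qed.

Lemma never_measurable n : measurable (never n).
Proof.
rewrite never_no_visit; apply: bigcapT_measurable => m.
exact: no_visit_measurable.
Qed.

Lemma alive_measurable n : measurable (alive n).
Proof.
rewrite (_ : alive n = ~` \bigcap_(l in [set: nat * 'I_d]) [set w | Z n w l = 0%N]).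
  apply: measurableC; apply: countable_bigcap_measurable => l _.
  exact: Zeq_measurable.
rewrite setC_bigcap; apply/seteqP; split=> w.
  by move=> [l /eqP Zl]; exists l.
by move=> [l _ /eqP Zl]; exists l.
Qed.

Lemma unseen_measurable N n : measurable (unseen N n).
Proof.
apply: measurableI; last exact: alive_measurable.
have [Nn|nN] := leqP N n.
  rewrite [X in measurable X](_ : _ = no_visit N (n - N)); last by rewrite /no_visit subnKC.
  exact: no_visit_measurable.
rewrite (_ : [set _ | _] = setT)//; apply/seteqP; split=> // w _ k l /andP[Nk kn].
by move: (leq_ltn_trans (leq_trans Nk kn) nN); rewrite ltnn.
Qed.

(** Induction on [t - n], revealing generation after generation until the history reaches [t]. The
    whole trajectory [z] up to [n] is recorded because [unseen N t] also depends on generations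
    before [t]. *)
Lemma unseen_contract (c : R) : (0 <= c)%R ->
  (forall l, exists m, (avoid m l <= c)%R) ->
  forall N t n H (z : nat -> types d -> nat), (n <= t)%N -> H `<=` G ->
  fresh H (future n) -> finsupport (z n) ->
  (forall w, H w -> forall k, (k <= n)%N -> forall l, Z k w l = z k l) ->
  P (H `&` (unseen N t `&` never t)) <= c%:E * P (H `&` unseen N t).
Proof.
move=> c0 avoidc N t n; have [k] := ubnP (t - n).
elim: k n => // k IH n tnk H z nt HG HD fz ZH; have mH := HD.1.
have mU := unseen_measurable N t.
move: nt; rewrite leq_eqVlt => /predU1P[nt|nt].
  (* A history that fixes all generations up to [t] is either contained in [unseen N t] or disjoint
     from it. *)
  subst t; have [[w0 [Hw0 [unseen0 [l alive0]]]]|HU] :=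
      pselect ((H `&` unseen N n) !=set0); last first.
    have HU0 : H `&` unseen N n = set0 by apply/eqP; apply: contra_notT HU => /set0P.
    by rewrite setIA HU0 set0I measure0 mule0.
  have HE : H `&` unseen N n = H.
    apply/setIidl => w Hw; split=> [j l' /andP[Nj jn] Al|].
      by rewrite (ZH _ Hw) // -(ZH _ Hw0)//; apply: unseen0 => //; rewrite Nj.
    by exists l; rewrite (ZH _ Hw)// -(ZH _ Hw0).
  (* One living type [l] suffices, so the horizon [m] may depend on [l] and need not be uniform. *)
  rewrite setIA HE; have [m mc] := avoidc l.
  apply: (@le_trans _ _ (P (H `&` no_visit n m))).
    apply: le_measure; rewrite ?inE//.
    - by apply: measurableI => //; exact: never_measurable.
    - by apply: measurableI => //; exact: no_visit_measurable.
    - by apply: setIS; rewrite never_no_visit; exact: bigcap_inf.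
  rewrite (no_visit_monom m HG HD fz); last by move=> w Hw l'; exact: ZH.
  rewrite muleC lee_wpmul2r// lee_fin; apply: le_trans mc.
  by apply: monom_le fz _; [exact: avoid01|rewrite -(ZH _ Hw0)].
apply: (@draws_contract n.+1 _ _ c H c0 _ _ _ (individuals n (z n)) H (future n) (fun=> 0%N)) => //.
- by apply: measurableI => //; exact: never_measurable.
- move=> H' z' H'H H'f fz' ZH'.
  apply: (IH n.+1 _ _ (fun k => if k == n.+1 then z' else z k)) => //.
  + by rewrite subnS prednK ?subn_gt0.
  + exact: subset_trans H'H HG.
  + by rewrite eqxx.
  + move=> w Hw j jn l; case: eqVneq => [->|jn']; first exact: ZH'.
    by apply: ZH; [exact: H'H|rewrite -ltnS ltn_neqAle jn' jn].
- exact: individuals_uniq.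
- by move=> s /ltnW.
- by move=> s /individuals_generation sn; rewrite /future /= sn.
- by apply: (sub_finite_set (B := set0)).
- by move=> w Hw l; rewrite (next_generation (HG _ Hw) fz (ZH _ Hw _ (leqnn _))).
Qed.

Lemma not_alive_next w n : G w -> ~ alive n w -> ~ alive n.+1 w.
Proof.
move=> Gw wn [l]; have Z0 k : Z n w k = 0%N.
  by apply/eqP; apply: contra_notT wn => wk; exists k.
apply/negP; rewrite negbK -(eqr_nat R) -eqe evolution// esum1// => j _.
by rewrite Z0 big_ord0.
Qed.

Lemma not_alive_later w n m : G w -> (n <= m)%N -> ~ alive n w -> ~ alive m w.
Proof.
move=> Gw /subnKC <- wn; elim: (m - n)%N => [|k IH]; first by rewrite addn0.
by rewrite addnS; exact: not_alive_next.
Qed.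

Lemma survival_unseen_null (c : R) (i : types d) : measurable G -> P G = 1 ->
  (forall w, G w -> forall l, Z 0%N w l = (l == i)) ->
  (0 <= c < 1)%R -> (forall l, exists m, (avoid m l <= c)%R) ->
  forall N, P (G `&` (never N `&` \bigcap_n alive n)) = 0.
Proof.
move=> mG PG ZG /andP[c0 c1] avoidc N.
set B := G `&` _.
have mB : measurable B.
  apply: measurableI => //; apply: measurableI; first exact: never_measurable.
  by apply: bigcapT_measurable => n; exact: alive_measurable.
have mF n : measurable (G `&` unseen N n).
  by apply: measurableI => //; exact: unseen_measurable.
have capF : \bigcap_n (G `&` unseen N n) = B.
  apply/seteqP; split=> w.
    move=> h; split; first by have [] := h 0%N I.
    split=> [k l Nk Al|n _]; last by have [_ []] := h n I.
    by have [_ [+ _]] := h k I; apply=> //; rewrite Nk leqnn.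
  move=> [Gw [wN wa]] n _; split=> //; split; last exact: wa.
  by move=> k l /andP[Nk _]; exact: wN.
have cvF : P (G `&` unseen N n) @[n --> \oo] --> P B.
  rewrite -capF; apply: nonincreasing_cvg_mu => //.
  - by rewrite (le_lt_trans (probability_le1 _ _)) ?ltry.
  - by rewrite capF.
  (* The events decrease because on [G] an empty generation stays empty. *)
  - move=> m n mn; apply/subsetPset => w [Gw [wu wa]]; split=> //; split.
      by move=> k l /andP[Nk km]; apply: wu; rewrite Nk (leq_trans km).
    by apply: contrapT => /(not_alive_later Gw mn).
have le_cF t : (N <= t)%N -> P B <= c%:E * P (G `&` unseen N t).
  move=> Nt; apply: (@le_trans _ _ (P (G `&` (unseen N t `&` never t)))).
    apply: le_measure; rewrite ?inE//.
      apply: measurableI => //; apply: measurableI; first exact: unseen_measurable.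
      exact: never_measurable.
    move=> w [Gw [wN wa]]; split=> //; split.
      by split; [move=> k l /andP[Nk _]; exact: wN|exact: wa].
    by move=> k l tk; apply: wN; exact: leq_trans tk.
  (* The initial history is [G] itself: it has probability 1, hence is fresh, and fixes generation 0
     as the single ancestor. *)
  apply: (@unseen_contract c c0 avoidc N t 0%N G (fun=> fun l => (l == i) : nat)) => //.
  - exact: freshT.
  - apply: (@sub_finite_set _ _ [set i]) => // l; rewrite /supp /=.
    by case: (l =P i).
  - by move=> w Gw k; rewrite leqn0 => /eqP -> l; exact: ZG.
(* The bounds [le_cF], valid from [t = N] on, pass to the limit. *)
have : P B <= c%:E * P B.
  apply: (cvge_ge _ (cvgeZl _ cvF)) => //; near=> t; apply: le_cF; near: t.
  exact: nbhs_infty_ge.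
rewrite (P_fin_num mB) -EFinM lee_fin => PBc; congr (_%:E).
have := fine_ge0 (measure_ge0 P B); nra.
Unshelve. all: by end_near.
Qed.

End Evolution.

Arguments avoid {R d} p A m j.
Arguments no_visit {d dW W} Z A n m.
Arguments never {d dW W} Z A n.
Arguments alive {d dW W} Z n.

(** * Visit counts and realizations of the process *)

Lemma visits_from_eq0 (R : realType) (d : nat) (dW : measure_display)
    (W : measurableType dW) (Z : nat -> W -> types d -> nat) (A : set (types d)) n w :
  visits_from R Z A n w = 0 <-> never Z A n w.
Proof.
have pop0 m l : (0 : \bar R) <= (Z m w l)%:R%:E by rewrite lee_fin.
split=> [v0 k l nk Al|wn]; last first.
  by apply: eseries0 => m nm _; apply: esum1 => l Al; rewrite (wn m).
have gen_ge0 m : 0 <= \esum_(j in A) (Z m w j)%:R%:E :> \bar R by exact: esum_ge0.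
have gen0 : \esum_(j in A) (Z k w j)%:R%:E = 0 :> \bar R.
  apply/eqP; rewrite eq_le gen_ge0 andbT -v0 /visits_from.
  (* The partial sum stops at [k.+1] so that generation [k] is its last term. *)
  apply: le_trans (nneseries_lim_ge k.+1 _) => //.
  by rewrite big_nat_recr//= leeDr// sume_ge0.
have [/(_ gen0 l Al) /eqP + _] := @esum_eq0P R _ A _ (pop0 k).
by rewrite eqe pnatr_eq0 => /eqP.
Qed.

(** The two almost sure clauses are gathered on one measurable event [G] of probability 1, so that
    later arguments are pointwise. *)
Lemma galton_watson_realization (R : realType) (d : nat) (dW : measure_display)
    (W : measurableType dW) (p : types d -> (types d -> nat) -> R)
    (P : probability W R) (i : types d) (Z : nat -> W -> types d -> nat) :
  galton_watson p P i Z ->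
  exists xi G, [/\ offspring_family p P xi, measurable G, P G = 1,
    forall w, G w -> forall l, Z 0%N w l = (l == i) &
    forall w, G w -> forall n l, (Z n.+1 w l)%:R%:E =
      \esum_(j in [set: types d])
        (\sum_(k < Z n w j) xi (n, j, k : nat) w l)%N%:R%:E :> \bar R].
Proof.
move=> [_ Z0 [xi fxi evo]]; exists xi.
have [N [mN PN NG]] := filterI Z0 evo.
have good w : (~` N) w -> _ := fun Nw => contrapT (fun h => Nw (NG w h)).
exists (~` N); split=> //.
- exact: measurableC.
- by rewrite probability_setC// PN sube0.
- by move=> w /good[].
- by move=> w /good[].
Qed.

(** * Extinction probabilities of the process *)

Section Process.
Context {R : realType} {d : nat} {dW : measure_display} {W : measurableType dW}.
Context {p : types d -> (types d -> nat) -> R}.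
Context {P : types d -> probability W R} {Z : nat -> W -> types d -> nat}.
Hypothesis process : block_LH_branching_process p P Z.

Let law := blhbp_law process.
Let hess := blhbp_hessenberg process.

Lemma process_measurable (i : types d) n l : measurable_fun [set: W] (fun w => Z n w l).
Proof. by have [mZ _ _] := blhbp_process process i; exact: mZ. Qed.

Lemma q0E A l : q0 P Z A l = P l (never Z A 0).
Proof. by rewrite /q0; congr (P l _); apply/seteqP; split=> w /visits_from_eq0; exact. Qed.

Lemma qE A l : q P Z A l = P l (\bigcup_n never Z A n).
Proof.
rewrite /q; congr (P l _); apply/seteqP; split=> w.
  by move=> [n /visits_from_eq0 nw]; exists n.
by move=> [n _ /visits_from_eq0 nw]; exists n.
Qed.

Lemma q0_le A B l : B `<=` A -> q0 P Z A l <= q0 P Z B l.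
Proof.
move=> BA; rewrite !q0E; apply: le_measure; rewrite ?inE.
- by apply: never_measurable => n k; exact: (process_measurable l).
- by apply: never_measurable => n k; exact: (process_measurable l).
- by move=> w wn k j ? /BA; exact: wn.
Qed.

(** Started from [l], the probability of no visit up to generation [m] is [avoid p A m l], and it
    decreases to [q0]; a strict bound is therefore reached at a finite horizon. *)
Lemma q0_lt_avoid A l (c : R) : q0 P Z A l < c%:E -> exists m, (avoid p A m l <= c)%R.
Proof.
move=> q0c; have mZ := process_measurable l.
have [xi [G [fxi mG PG ZG evo]]] := galton_watson_realization (blhbp_process process l).
apply: contrapT => noc.
have mNV m : measurable (no_visit Z A 0 m) by exact: no_visit_measurable.
have cvq : P l (no_visit Z A 0 m) @[m --> \oo] --> q0 P Z A l.
  rewrite q0E never_no_visit; apply: nonincreasing_cvg_mu => //.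
  - by rewrite (le_lt_trans (probability_le1 _ _)) ?ltry.
  - exact: bigcapT_measurable.
  - move=> m n mn; apply/subsetPset => w wn k j /andP[_ km]; apply: wn.
    by rewrite (leq_trans km).
have : c%:E <= q0 P Z A l.
  apply: (cvge_ge _ cvq); apply: nearW => m.
  rewrite -(probability_setI1 mG (mNV m) PG).
  rewrite (no_visit_monom law hess fxi mZ evo m (n := 0%N) (z := fun l' => (l' == l) : nat))//.
  - rewrite PG mul1e monom1 lee_fin leNgt; apply/negP => /ltW cm; apply: noc.
    by exists m.
  - exact: freshT.
  - apply: (@sub_finite_set _ _ [set l]) => // l'; rewrite /supp /=.
    by case: (l' =P l).
by rewrite leNgt q0c.
Qed.

(** Up to the null events of surviving without visiting [A] after some [N], finitely many visits to
    [A] mean extinction. *)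
Lemma q_eq_global_extinction A (c : R) : (c < 1)%R ->
  (forall l, q0 P Z A l <= c%:E) -> q P Z A = q P Z [set: types d].
Proof.
move=> c1 q0c; apply/funext => i; rewrite !qE.
have mZ := process_measurable i.
have mnever B n : measurable (never Z B n) by exact: never_measurable.
have [xi [G [fxi mG PG ZG evo]]] := galton_watson_realization (blhbp_process process i).
have c0 : (0 <= c)%R by rewrite -lee_fin (le_trans _ (q0c i)).
(* The midpoint between [c] and 1 supplies the strict inequality required by [q0_lt_avoid]. *)
pose c' := ((c + 1) / 2)%R.
have c'01 : (0 <= c' < 1)%R by rewrite /c'; lra.
have avoidc l : exists m, (avoid p A m l <= c')%R.
  by apply: q0_lt_avoid; rewrite (le_lt_trans (q0c l))// lte_fin /c'; lra.
pose B N := G `&` (never Z A N `&` \bigcap_n alive Z n).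
have null N : P i (B N) = 0 := survival_unseen_null law hess fxi mZ evo mG PG ZG c'01 avoidc N.
have mB N : measurable (B N).
  apply: measurableI => //; apply: measurableI => //.
  by apply: bigcapT_measurable => n; exact: alive_measurable.
have PB : P i (\bigcup_N B N) = 0.
  apply/negligibleP; first exact: bigcupT_measurable.
  by apply: negligible_bigcup => N; apply/negligibleP; [exact: mB|exact: null].
have mU C : measurable (\bigcup_n never Z C n) by exact: bigcupT_measurable.
apply/eqP; rewrite eq_le; apply/andP; split; last first.
  apply: le_measure; rewrite ?inE// => w [n _ wn]; exists n => // k l nk _.
  exact: wn.
rewrite -(probability_setI1 mG (mU A) PG) -[leRHS](measureU0 (mU _) _ PB); last first.
  exact: bigcupT_measurable.
apply: le_measure; rewrite ?inE//; first exact: measurableI.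
  by apply: measurableU => //; exact: bigcupT_measurable.
move=> w [Gw [N _ wN]]; have [wa|] := pselect (forall n, alive Z n w).
  by right; exists N => //; split=> //; split=> // n _; exact: wa.
move=> /existsNP[n wn]; left; exists n => // k l nk _; apply: contrapT => /eqP wk.
by apply: (not_alive_later evo Gw nk wn); exists l.
Qed.

End Process.

(** The sets closed under change of level within a phase form a sigma-algebra containing every phase
    set, hence the generated one. *)
Lemma sigma_phase_set (d : nat) (A : set (types d)) :
  <<s range (@phase_set d) >> A -> forall x, A x -> phase_set x.2 `<=` A.
Proof.
move=> A_sigma.
suff : <<s range (@phase_set d) >> `<=`
    [set B : set (types d) | forall x y : types d, x.2 = y.2 -> B x -> B y].
  by move=> /(_ A A_sigma) sat x Ax y /= /esym xy; exact: sat Ax.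
apply: smallest_sub; last by move=> _ [i _ <-] x y xy; rewrite /phase_set /= -xy.
split=> //=.
- by move=> B sat x y /esym xy [_ Bx]; split=> // /(sat _ _ xy).
- by move=> F sat x y xy [n _ Fx]; exists n => //; exact: sat Fx.
Qed.

Theorem corollary2 (R : realType) (d : nat) (d_ge1 : (1 <= d)%N)
    (dW : measure_display) (W : measurableType dW)
    (p : types d -> (types d -> nat) -> R)
    (P : types d -> probability W R) (Z : nat -> W -> types d -> nat)
    (Z_process : block_LH_branching_process p P Z)
    (sup_q0_lt1 : forall i j : 'I_d,
       ereal_sup [set q0 P Z (phase_set j) l | l in phase_set i] < 1)
    (A : set (types d)) (A_sigma : <<s range (@phase_set d) >> A)
    (A_nonempty : A !=set0) :
  q P Z A = q P Z [set: types d].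
Proof.
have [x Ax] := A_nonempty; have phaseA := sigma_phase_set A_sigma Ax.
(* A maximum over finitely many starting phases stays below 1 and bounds [q0] uniformly over all
   types; the default 0 makes it nonnegative, hence finite. *)
pose s := \big[maxe/0]_(i < d) ereal_sup [set q0 P Z (phase_set x.2) l | l in phase_set i].
have s1 : s < 1 by apply: bigmax_lt => // i _; exact: sup_q0_lt1.
have s_ge0 : 0 <= s by exact: bigmax_ge_id.
have s_fin : s \is a fin_num by rewrite ge0_fin_numE// (lt_trans s1) ?ltry.
apply: (q_eq_global_extinction Z_process (c := fine s)).
  by rewrite -lte_fin fineK.
(* Since [A] contains the whole phase of [x], avoiding [A] is at most as likely as avoiding that
   phase. *)
move=> l; rewrite fineK//; apply: le_trans (q0_le Z_process l phaseA) _.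
apply: (le_trans _ (le_bigmax _ _ l.2)).
by apply: ereal_sup_ubound; exists l.
Qed.
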